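(* Let $k$ be an infinite field of characteristic $p>2$. Then $L_2=L_3$.
   Context: Let $X=\{x_1,x_2,\ldots\}$ be a countably infinite set and let $k_0\langle X\rangle$ denote the free associative $k$-algebra (without identity) on $X$. A $T$-space of $k_0\langle X\rangle$ is a $k$-linear subspace closed under every algebra endomorphism of $k_0\langle X\rangle$; the $T$-space generated by a subset is the smallest $T$-space containing it. Let $L_1$ be the $T$-space generated by $x_1^p$, and for $n\ge1$ let $L_{n+1}$ be the $T$-space generated by $L_n$ together with all products $u\,v^p$ with $u\in L_n$, $v\in k_0\langle X\rangle$ (equivalently, by $L_n\cup L_n x_{n+1}^p$). Thus $L_n$ is the $T$-space generated by $x_1^p, x_1^px_2^p,\ldots,x_1^p\cdots x_n^p$. *)

(* Defs.v *)
From HB Require Import structures.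
From mathcomp Require Import all_boot all_algebra.
From mathcomp.multinomials Require Import monalg.

Set Implicit Arguments.
Unset Strict Implicit.
Unset Printing Implicit Defensive.

Import GRing.Theory.
Local Open Scope ring_scope.

(* The free associative unital algebra k<X> on X = {x_1, x_2, ...}:
   finitely supported k-linear combinations of words over nat
   (the free monoid {fmonom nat}); the letter (i-1) : nat encodes x_i. *)
Notation Falg k := {malg k[{fmonom nat}]}.

Definition xvar (k : fieldType) (i : nat) : Falg k := << fmu i.-1 >>.

Definition in_k0 (k : fieldType) (f : Falg k) : Prop := f@_(@mone _) = 0.

(* An algebra endomorphism of k_0<X>: a map that sends k_0<X> to itself and
   whose restriction to k_0<X> is k-linear and multiplicative.  (Its values
   outside k_0<X> are irrelevant.) *)
Definition is_endo (k : fieldType) (phi : Falg k -> Falg k) : Prop :=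
  (forall f, in_k0 f -> in_k0 (phi f)) /\
  (forall (a : k) f g, in_k0 f -> in_k0 g -> phi (a *: f + g) = a *: phi f + phi g) /\
  (forall f g, in_k0 f -> in_k0 g -> phi (f * g) = phi f * phi g).

Definition is_Tspace (k : fieldType) (V : Falg k -> Prop) : Prop :=
  (forall f, V f -> in_k0 f) /\
  V 0 /\
  (forall (a : k) f g, V f -> V g -> V (a *: f + g)) /\
  (forall phi, is_endo phi -> forall f, V f -> V (phi f)).

Definition Tgen (k : fieldType) (S : Falg k -> Prop) : Falg k -> Prop :=
  fun f => forall V, is_Tspace V -> (forall g, S g -> V g) -> V f.

(* Lrec p n = L_{n+1}:  L_1 = T-space generated by x_1^p,
   L_{n+1} = T-space generated by L_n and all u v^p, u in L_n, v in k_0<X>. *)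
Fixpoint Lrec (k : fieldType) (p : nat) (n : nat) : Falg k -> Prop :=
  match n with
  | 0 => @Tgen k (fun f => f = xvar k 1 ^+ p)
  | m.+1 => @Tgen k (fun f => @Lrec k p m f \/
              exists u v, @Lrec k p m u /\ in_k0 v /\ f = u * v ^+ p)
  end.

Definition L (k : fieldType) (p : nat) (n : nat) : Falg k -> Prop :=
  @Lrec k p n.-1.

(* Main.v *)
(* Let B be the span of the p-th powers of elements of k_0<X> and V = B + B B.
   Then L_1 = B and L_2 = V, and it suffices to show x^p y^p z^p \in V.

   Write D w = [w, x].  In characteristic p, D^(p-1) v = sum_i x^i v x^(p-1-i) is
   the part of (x + v)^p linear in v, so it lies in B and B is a Lie ideal of
   k<X>.  By Herstein's argument, [u, v] r = [u, v r] - v [u, r], the ideal I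
   generated by [B, B] lies in V; replace B by B + I.

   If [c, A] <= B then D (D c * s) \in B for all s (this uses p <> 2), hence
   D^(p-1) (c v) = D (c D^(p-2) v) modulo B, that is,
   c D^(p-1) v + D c * D^(p-2) v \in B.  Taking c = b (and multiplying by a),
   c = a b and c = b a, for a, b \in B, and combining, a b D^(p-1) v \in V.

   By Jacobson's formula a b ((x + y)^p - x^p - y^p) \in V, so p-th powering is
   additive in the symmetric trilinear form (a, b, c) |-> a b c on B modulo V.  As
   z^p u^p u^p = z^p (u^2)^p \in V for every u, polarization at u = x + y gives
   2 z^p x^p y^p \in V. *)
Require Import Defs.
From HB Require Import structures.
From mathcomp Require Import all_boot all_algebra.
From mathcomp.multinomials Require Import monalg.

Set Implicit Arguments.
Unset Strict Implicit.
Unset Printing Implicit Defensive.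

Import GRing.Theory.
Local Open Scope ring_scope.

(** * Linear spans, and extraction of coefficients over an infinite field *)

Definition subspace (k : fieldType) (A : lmodType k) (K : A -> Prop) : Prop :=
  K 0 /\ forall (a : k) f g, K f -> K g -> K (a *: f + g).

Definition lin_span (k : fieldType) (A : lmodType k) (S : A -> Prop) (f : A) :
  Prop := forall K, subspace K -> (forall g, S g -> K g) -> K f.

Section Subspace.
Variables (k : fieldType) (A : lmodType k).
Implicit Types (K S : A -> Prop) (f g : A).

Lemma subspaceD K f g : subspace K -> K f -> K g -> K (f + g).
Proof. by case=> _ sK Kf Kg; rewrite -[f]scale1r; apply: sK. Qed.

Lemma subspaceZ K a f : subspace K -> K f -> K (a *: f).
Proof. by case=> K0 sK Kf; rewrite -[_ *: _]addr0; apply: sK. Qed.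

Lemma subspaceN K f : subspace K -> K f -> K (- f).
Proof. by move=> sK Kf; rewrite -scaleN1r; apply: subspaceZ. Qed.

Lemma subspaceB K f g : subspace K -> K f -> K g -> K (f - g).
Proof. by move=> sK Kf Kg; apply: subspaceD => //; apply: subspaceN. Qed.

Lemma subspace_sum K (I : Type) (r : seq I) (P : pred I) (F : I -> A) :
  subspace K -> (forall i, P i -> K (F i)) -> K (\sum_(i <- r | P i) F i).
Proof.
by move=> sK KF; elim/big_ind: _ => // [|*]; [case: sK | apply: subspaceD].
Qed.

Lemma lin_span_subspace S : subspace (lin_span S).
Proof.
split=> [K [] //|a f g Sf Sg K sK SK].
by case: (sK) => _; apply; [apply: Sf | apply: Sg].
Qed.

Lemma mem_lin_span S f : S f -> lin_span S f.
Proof. by move=> Sf K _; apply. Qed.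

Hypothesis infk : forall s : seq k, exists x : k, x \notin s.

Lemma uniq_seq_of_size n : exists2 s : seq k, uniq s & size s = n.
Proof.
elim: n => [|n [s us <-]]; first by exists [::].
by have [x xs] := infk s; exists (x :: s); rewrite //= xs.
Qed.

(** An infinite field has [n] distinct nodes; inverting their Vandermonde matrix writes each
    coefficient as a combination of values. *)
Lemma subspace_coef K n (w : nat -> A) : subspace K ->
    (forall t : k, K (\sum_(j < n) t ^+ j *: w j)) ->
  forall m, (m < n)%N -> K (w m).
Proof.
move=> sK Kt m lt_mn; have [s us sn] := uniq_seq_of_size n.
pose M := Vandermonde n (\row_(i < n) s`_i).
have uM : M \in unitmx.
  rewrite unitmxE det_Vandermonde unitfE; apply/prodf_neq0 => i _.
  apply/prodf_neq0 => j lt_ij; rewrite !mxE subr_eq0 nth_uniq ?sn //.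
  by rewrite gtn_eqF.
pose m' := Ordinal lt_mn.
suff -> : w m = \sum_(j < n) invmx M j m' *: \sum_(i < n) s`_j ^+ i *: w i.
  by apply: subspace_sum => // j _; apply: subspaceZ.
under eq_bigr do rewrite scaler_sumr.
rewrite exchange_big (bigD1 m') //= [X in _ + X]big1 ?addr0 => [|i ne_im].
  under eq_bigr do rewrite scalerA mulrC; rewrite -scaler_suml.
  have /matrixP/(_ m' m') := mulmxV uM; rewrite !mxE eqxx.
  by under eq_bigr do rewrite !mxE; move=> ->; rewrite scale1r.
under eq_bigr do rewrite scalerA mulrC; rewrite -scaler_suml.
have /matrixP/(_ i m') := mulmxV uM; rewrite !mxE (negPf ne_im).
by under eq_bigr do rewrite !mxE; move=> ->; rewrite scale0r.
Qed.

End Subspace.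

(** * Commutators and iterated inner derivations *)

Section Lie.
Variables (k : fieldType) (A : algType k).
Implicit Types (a b c f s t u v w x y : A).

Definition lie u v := u * v - v * u.

Lemma liexx u : lie u u = 0.
Proof. exact: subrr. Qed.

Lemma lieDl u v w : lie (u + v) w = lie u w + lie v w.
Proof. by rewrite /lie mulrDl mulrDr opprD addrACA. Qed.

Lemma lieZl (e : k) u v : lie (e *: u) v = e *: lie u v.
Proof. by rewrite /lie -scalerAl -scalerAr scalerBr. Qed.

Lemma lieMl u v w : lie (u * v) w = u * lie v w + lie u w * v.
Proof. by rewrite /lie mulrBl mulrBr !mulrA addrA subrK. Qed.

Lemma lieMr u v w : lie u (v * w) = lie u v * w + v * lie u w.
Proof. by rewrite /lie mulrBl mulrBr !mulrA addrA subrK. Qed.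

Lemma mul_lie u v : u * v = lie u v + v * u.
Proof. by rewrite /lie subrK. Qed.

Definition ad x n v := iter n (lie^~ x) v.

Lemma adS x n v : ad x n.+1 v = lie (ad x n v) x.
Proof. by []. Qed.

Lemma adSr x n v : ad x n.+1 v = ad x n (lie v x).
Proof. exact: iterSr. Qed.

Lemma adD x n u v : ad x n (u + v) = ad x n u + ad x n v.
Proof. by elim: n => //= n ->; rewrite lieDl. Qed.

(** Binomial theorem for right minus left multiplication by [x], two commuting operators; the
    induction is Pascal's rule. *)
Lemma adE x n v :
  ad x n v =
  \sum_(i < n.+1) ((-1) ^+ i *+ 'C(n, i)) *: (x ^+ i * v * x ^+ (n - i)).
Proof.
elim: n => [|n IHn]; first by rewrite big_ord1 bin0 expr0 scale1r mul1r mulr1.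
rewrite adS IHn /lie mulr_suml mulr_sumr -sumrB.
pose F m i := (-1) ^+ i *: (x ^+ i * v * x ^+ (m - i)).
transitivity (\sum_(i < n.+1) (F n.+1 i *+ 'C(n, i) + F n.+1 i.+1 *+ 'C(n, i))).
  apply: eq_bigr => i _; rewrite -scalerMnl mulrnAl mulrnAr -mulrnBl -mulrnDl.
  rewrite /F subSS -scalerAl -scalerAr exprSr mulrN1 scaleNr exprS !mulrA.
  by rewrite -[_ * x]mulrA -exprSr subSn // -ltnS.
rewrite big_split /= big_ord_recl big_ord_recr [RHS]big_ord_recl /=.
rewrite big_ord_recr /= -!scalerMnl !bin0 !binn -!addrA; congr (_ + _).
rewrite !addrA /F subnn /= ?bin0 ; congr (_ + _).
rewrite -big_split /=; apply: eq_bigr => i _.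
by rewrite -scalerMnl [in RHS]/bump binS mulrnDr.
Qed.

End Lie.

(** * Powers of a linear pencil and their derivatives *)

Section Pencil.
Variables (k : fieldType) (A : algType k).
Implicit Types (x y : A) (t : k).

Definition pencil x y : {poly A} := x%:P * 'X + y%:P.

(** Over a noncommutative ring evaluation is multiplicative at central points, such as the scalars
    [t%:A]. *)
Let comm_poly_scalar (q : {poly A}) t : comm_poly q t%:A.
Proof. by rewrite /comm_poly mulr_algl mulr_algr. Qed.

Lemma horner_pencil_exp x y t n : (pencil x y ^+ n).[t%:A] = (t *: x + y) ^+ n.
Proof.
rewrite horner_exp_comm // hornerD hornerM_comm //.
by rewrite hornerX !hornerC mulr_algr.
Qed.

Lemma deriv_exp_sum (h : {poly A}) n :
  (h ^+ n)^`() = \sum_(i < n) h ^+ i * h^`() * h ^+ (n.-1 - i).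
Proof.
elim: n => [|n IHn]; first by rewrite big_ord0 derivC.
rewrite exprSr derivM IHn big_ord_recr /= subnn mulr1; congr (_ + _).
rewrite mulr_suml; apply: eq_bigr => i _; rewrite -mulrA -exprSr.
by case: n i {IHn} => [[]//|n] i /=; rewrite subSn // -ltnS.
Qed.

(** For [n = p] in characteristic [p] the right side is [ad (t *: x + y) p.-1 x]. So the
    coefficients of the derivative, divided by [j.+1 < p], give the mixed terms of Jacobson's
    formula. *)
Lemma horner_deriv_pencil_exp x y t n :
  (pencil x y ^+ n)^`().[t%:A] =
  \sum_(i < n) (t *: x + y) ^+ i * x * (t *: x + y) ^+ (n.-1 - i).
Proof.
rewrite deriv_exp_sum horner_sum; apply: eq_bigr => i _.
rewrite !hornerM_comm // !horner_pencil_exp; congr (_ * _ * _).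
by rewrite derivD derivC derivM derivX derivC mul0r add0r mulr1 addr0 hornerC.
Qed.

Lemma horner_alg_wide (q : {poly A}) n t :
  (size q <= n)%N -> q.[t%:A] = \sum_(i < n) t ^+ i *: q`_i.
Proof.
move=> szq; rewrite (horner_coef_wide _ szq); apply: eq_bigr => i _.
by rewrite exprZn expr1n mulr_algr.
Qed.

Lemma coef_pencil_exp x y n i :
  (n <= i)%N -> (pencil x y ^+ n)`_i = x ^+ n *+ (i == n).
Proof.
elim: n i => [|n IHn] i; first by rewrite !expr0 coef1.
case: i => // i le_ni.
rewrite exprSr mulrDr mulrA coefD coefMX /= !coefMC !IHn ?(ltnW le_ni) //.
by rewrite [i.+1 == n]gtn_eqF // mulr0n mul0r addr0 eqSS exprSr mulrnAl.
Qed.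

Lemma size_pencil_exp x y n : (size (pencil x y ^+ n) <= n.+1)%N.
Proof.
by apply/leq_sizeP => j lt_nj; rewrite coef_pencil_exp ?(ltnW lt_nj) // gtn_eqF.
Qed.

End Pencil.

Lemma lie_exp (k : fieldType) (A : algType k) (u s : A) n :
  lie (u ^+ n) s = \sum_(i < n) u ^+ i * lie u s * u ^+ (n.-1 - i).
Proof.
elim: n => [|n IHn]; first by rewrite big_ord0 expr0 /lie mul1r mulr1 subrr.
rewrite exprSr lieMl IHn big_ord_recr /= subnn mulr1 addrC; congr (_ + _).
rewrite mulr_suml; apply: eq_bigr => i _; rewrite -mulrA -exprSr.
by case: n i {IHn} => [[]//|n] i /=; rewrite subSn // -ltnS.
Qed.

(** * Iterated derivations in characteristic p *)

Section CharP.
Variables (k : fieldType) (A : algType k) (p : nat).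
Hypothesis pk : p \in [pchar k].
Implicit Types (u v x y : A).

Let p_gt0 : (0 < p)%N := prime_gt0 (pcharf_prime pk).

(** Pascal's rule and the vanishing of C(p, i+1) modulo p make consecutive C(p-1, i) opposite. *)
Lemma sign_bin_pchar i : (i < p)%N -> (-1) ^+ i *+ 'C(p.-1, i) = 1 :> k.
Proof.
elim: i => [|i IHi] lt_ip; first by rewrite bin0.
have: 'C(p, i.+1)%:R == 0 :> k.
  by rewrite -(dvdn_pcharf pk) prime_dvd_bin // (pcharf_prime pk).
rewrite -(prednK p_gt0) binS natrD addr_eq0 => /eqP Ci.
by rewrite -mulr_natr Ci mulrN exprS mulN1r mulNr opprK mulr_natr IHi // ltnW.
Qed.

Lemma ad_pchar x v : ad x p.-1 v = \sum_(i < p) x ^+ i * v * x ^+ (p.-1 - i).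
Proof.
rewrite adE prednK //; apply: eq_bigr => i _.
by rewrite sign_bin_pchar // scale1r.
Qed.

End CharP.

(** * Lie ideals, and products a b D^(p-1) v *)

Section LieIdeal.
Variables (k : fieldType) (A : algType k) (B : A -> Prop).
Hypotheses (two_neq0 : 2%:R != 0 :> k) (sB : subspace B).
Hypothesis lieB : forall b s, B b -> B (lie b s).
Implicit Types b c s v x : A.

Lemma subspace_half (K : A -> Prop) f : subspace K -> K (f + f) -> K f.
Proof.
move=> sK Kff; rewrite -[f]scale1r -(mulVf two_neq0) -scalerA scaler_nat mulr2n.
exact: subspaceZ.
Qed.

Lemma adB x n b : B b -> B (ad x n b).
Proof. by move=> Bb; elim: n => //= n; apply: lieB. Qed.

(** Twice the element is [c, x^2] + [[c, x], x], and 2 is invertible. *)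
Lemma lie_mul_self c x : (forall s, B (lie c s)) -> B (lie c x * x).
Proof.
move=> lie_c; apply: subspace_half => //.
have -> : lie c x * x + lie c x * x = lie c (x * x) + lie (lie c x) x.
  by rewrite lieMr {2}(mul_lie (lie c x) x) addrA addrAC.
by apply: subspaceD => //; apply: lieB.
Qed.

(** In [c, x] s = [[c, x], s] + [c, s x] - [c, s] x the first two terms lie in [B]; bracketing the
    last with [x] gives [[c, s], x] x, an instance of [lie_mul_self]. *)
Lemma lie_lie_mul c x s : (forall s, B (lie c s)) -> B (lie (lie c x * s) x).
Proof.
move=> lie_c.
have -> : lie c x * s = lie (lie c x) s + lie c (s * x) - lie c s * x.
  by rewrite lieMr [lie c s * x + _]addrC addrA addrK; apply: mul_lie.
rewrite 2!lieDl -scaleN1r lieZl scaleN1r lieMl liexx mulr0 add0r.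
apply: subspaceB => //.
  by apply: subspaceD => //; apply: lieB => //; apply: lieB.
by apply: lie_mul_self => t; apply: lieB.
Qed.

(** Leibniz: D (c v) = c D v + D c * v, and the second term falls into [B] after one more D. *)
Lemma ad_mul_shift c x n v : (forall s, B (lie c s)) ->
  B (ad x n.+1 (c * v) - lie (c * ad x n v) x).
Proof.
move=> lie_c; elim: n v => [|n IHn] v; first by rewrite subrr; case: sB.
rewrite adSr lieMl adD addrAC [ad x n.+1 v]adSr.
apply: subspaceD => //.
by rewrite adSr; apply/adB/lie_lie_mul.
Qed.

Lemma mul_ad c x n v : (forall s, B (lie c s)) -> B (ad x n.+1 (c * v)) ->
  B (c * ad x n.+1 v + lie c x * ad x n v).
Proof.
move=> lie_c Bcv; rewrite -lieMl -[lie _ _](subKr (ad x n.+1 (c * v))).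
by apply: subspaceB => //; apply: ad_mul_shift.
Qed.

End LieIdeal.

(* In the application R is k_0<X>, B is the span of the p-th powers of elements
   of R, V = B + B B and n.+1 = p - 1. *)
Section Product.
Variables (k : fieldType) (A : algType k) (R B V : A -> Prop) (n : nat).
Hypotheses (two_neq0 : 2%:R != 0 :> k) (sB : subspace B) (sV : subspace V).
Hypothesis lieB : forall b s, B b -> B (lie b s).
Hypothesis lieV : forall f s, V f -> V (lie f s).
Hypothesis RM : forall c v, R v -> R (c * v).
Hypothesis ad_in_B : forall x v, R x -> R v -> B (ad x n.+1 v).
Hypothesis BV : forall b, B b -> V b.
Hypothesis BBV : forall a b, B a -> B b -> V (a * b).
Implicit Types a b c f s t v x : A.

(** The largest two-sided ideal of [A] inside [V]. Being an ideal is immediate for it; that it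
    contains [B, B] is shown in [I_lie]. *)
Let I f := forall s t, V (s * f * t).

Let IV f : I f -> V f.
Proof. by move/(_ 1 1); rewrite mul1r mulr1. Qed.

Let sI : subspace I.
Proof.
split=> [s t|e f g If Ig s t]; first by rewrite mulr0 mul0r; case: sV.
rewrite mulrDr mulrDl -scalerAr -scalerAl.
by apply: subspaceD => //; apply: subspaceZ.
Qed.

Let IMl s f : I f -> I (s * f).
Proof. by move=> If u v; rewrite mulrA. Qed.

Let IMr s f : I f -> I (f * s).
Proof. by move=> If u v; rewrite mulrA -mulrA. Qed.

(* Herstein: A [B, B] A <= B + B B for every Lie ideal B of A. *)
Let I_lie a b : B a -> B b -> I (lie a b).
Proof.
move=> Ba Bb s t.
have Vt u : V (lie a b * u).
  rewrite -[_ * u](addrK (b * lie a u)) -lieMr.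
  by apply: subspaceB => //; [apply/BV/lieB | apply: BBV => //; apply: lieB].
rewrite -mulrA -[s * _](subKr (lie a b * t * s)) -mulrA.
by apply: subspaceB => //; rewrite mulrA; apply: lieV.
Qed.

(* Modulo I the elements of B commute, and B + I is still a Lie ideal with
   B (B + I) <= V; this replaces passing to the quotient A / I. *)
Let Bh f := exists b i, [/\ B b, I i & f = b + i].

Let BBh b : B b -> Bh b.
Proof. by move=> Bb; exists b, 0; split; rewrite ?addr0 //; case: sI. Qed.

Let IBh i : I i -> Bh i.
Proof. by move=> Ii; exists 0, i; split; rewrite ?add0r //; case: sB. Qed.

Let sBh : subspace Bh.
Proof.
split=> [|e _ _ [b [i [Bb Ii ->]]] [c [j [Bc Ij ->]]]].
  by apply: BBh; case: sB.
exists (e *: b + c), (e *: i + j); split.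
- by case: sB => _; apply.
- by case: sI => _; apply.
- by rewrite scalerDr addrACA.
Qed.

Let lieBh f s : Bh f -> Bh (lie f s).
Proof.
case=> b [i [Bb Ii ->]]; rewrite lieDl; apply: subspaceD => //.
  by apply/BBh/lieB.
by apply: IBh; apply: (subspaceB sI); [apply: IMr | apply: IMl].
Qed.

(** [a b, s] = [b, a s] - [b, a] s + [a, s b] - s [a, b]. This allows c = a b in [mul_ad], with [Bh]
    as the Lie ideal. *)
Let lie_mul_Bh a b s : B a -> B b -> Bh (lie (a * b) s).
Proof.
move=> Ba Bb.
have -> : lie (a * b) s =
    lie b (a * s) - lie b a * s + (lie a (s * b) - s * lie a b).
  by rewrite lieMl !lieMr addrK [lie b a * s + _]addrC addrK.
apply: subspaceD => //; apply: subspaceB => //.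
- by apply/BBh/lieB.
- by apply/IBh/IMr/I_lie.
- by apply/BBh/lieB.
- by apply/IBh/IMl/I_lie.
Qed.

Let mulBBh a f : B a -> Bh f -> V (a * f).
Proof.
move=> Ba [b [i [Bb Ii ->]]]; rewrite mulrDr; apply: subspaceD => //.
  exact: BBV.
by apply/IV/IMl.
Qed.

Lemma mul_mul_ad a b x v :
  B a -> B b -> R x -> R v -> V (a * b * ad x n.+1 v).
Proof.
move=> Ba Bb Rx Rv.
have adBh c : (forall s, Bh (lie c s)) ->
    Bh (c * ad x n.+1 v + lie c x * ad x n v).
  by move=> ?; apply: mul_ad => //; apply/BBh/ad_in_B/RM.
move: (ad x n.+1 v) (ad x n v) adBh => E F adBh.
have inner c : B c -> forall s, Bh (lie c s) by move=> Bc s; apply/BBh/lieB.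
have BhV f : Bh f -> V f.
  by case=> d [i [Bd Ii ->]]; apply: subspaceD => //; [apply: BV | apply: IV].
(* The relation for c = a' b' minus a' times the relation for c = b' leaves exactly D a' * b' F. *)
have VlF a' b' : B a' -> B b' -> V (lie a' x * b' * F).
  move=> Ba' Bb'.
  have V1 := BhV _ (adBh _ (fun s => lie_mul_Bh s Ba' Bb')).
  have := subspaceB sV V1 (mulBBh Ba' (adBh _ (inner _ Bb'))).
  rewrite lieMl mulrDl (mulrDr a' (b' * E)) !mulrA opprD addrACA subrr add0r.
  by rewrite addrAC subrr add0r.
have := mulBBh Ba (adBh _ (inner _ Bb)).
rewrite (mulrDr a (b * E)) !mulrA => V1.
(* Modulo [I] the factors [a] and D b commute, so [VlF] applies with the roles of [a] and [b]
   exchanged. *)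
have V2 : V (a * lie b x * F).
  rewrite (mul_lie a (lie b x)) mulrDl; apply: subspaceD => //; last exact: VlF.
  by apply/IV/IMr/I_lie => //; apply: lieB.
by rewrite -[_ * E](addrK (a * lie b x * F)); apply: subspaceB.
Qed.

End Product.

(** * The span of p-th powers and of products of two of them *)

Section Powers.
Variables (k : fieldType) (A : algType k) (R : A -> Prop) (p : nat).
Hypothesis infk : forall s : seq k, exists x : k, x \notin s.
Hypotheses (pk : p \in [pchar k]) (p_gt2 : (2 < p)%N).
Hypothesis sR : subspace R.
Hypothesis RMl : forall s v, R v -> R (s * v).
Hypothesis RMr : forall s v, R v -> R (v * s).
Implicit Types a b f s u v x y z : A.

Definition is_pow f := exists2 u, R u & f = u ^+ p.

Definition is_pow_mul f := exists u v, [/\ R u, R v & f = u ^+ p * v ^+ p].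

Definition powers : A -> Prop := lin_span is_pow.

Definition power_products : A -> Prop :=
  lin_span (fun f => is_pow f \/ is_pow_mul f).

Local Notation B := powers.
Local Notation V := power_products.

Let sB : subspace B. Proof. exact: lin_span_subspace. Qed.
Let sV : subspace V. Proof. exact: lin_span_subspace. Qed.

Let powB u : R u -> B (u ^+ p).
Proof. by move=> Ru; apply: mem_lin_span; exists u. Qed.

Lemma powers_sub_power_products b : B b -> V b.
Proof.
move=> Bb; apply: (Bb _ sV) => f pf.
by apply: mem_lin_span; left.
Qed.

Lemma mul_powers a b : B a -> B b -> V (a * b).
Proof.
move=> Ba Bb; apply: (Ba (fun a => V (a * b))) => [|_ [u Ru ->]].
  split=> [|e f g Vf Vg]; first by rewrite mul0r; case: sV.
  by rewrite mulrDl -scalerAl; case: sV => _; apply.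
apply: (Bb (fun b => V (u ^+ p * b))) => [|_ [v Rv ->]].
  split=> [|e f g Vf Vg]; first by rewrite mulr0; case: sV.
  by rewrite mulrDr -scalerAr; case: sV => _; apply.
by apply: mem_lin_span; right; exists u, v.
Qed.

(** This is the coefficient of t in (t v + x)^p, whose values at all scalars t are p-th powers; it
    is computed as the derivative at 0. *)
Lemma ad_powers x v : R x -> R v -> B (ad x p.-1 v).
Proof.
move=> Rx Rv.
have : B (pencil v x ^+ p)`_1.
  apply: (subspace_coef infk (n := p.+1)) => // [t|].
    2: by rewrite ltnS ltnW // ltnW.
  rewrite -horner_alg_wide ?size_pencil_exp // horner_pencil_exp.
  by apply: powB; case: sR => _; apply.
congr (B _); rewrite -[LHS]mulr1n -coef_deriv -horner_coef0.
have := horner_deriv_pencil_exp v x 0 p; rewrite !scale0r add0r => ->.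
by rewrite ad_pchar.
Qed.

(** Leibniz gives [u^p, s] = D^(p-1) [u, s] with D = [-, u]. *)
Lemma lie_powers b s : B b -> B (lie b s).
Proof.
move=> Bb; apply: (Bb (fun b => B (lie b s))) => [|_ [u Ru ->]].
  split=> [|e f g Vf Vg]; first by rewrite /lie mul0r mulr0 subrr; case: sB.
  by rewrite lieDl lieZl; case: sB => _; apply.
rewrite lie_exp -ad_pchar //; apply: ad_powers => //.
by apply: subspaceB => //; [apply: RMr | apply: RMl].
Qed.

Lemma lie_power_products f s : V f -> V (lie f s).
Proof.
move=> Vf; apply: (Vf (fun f => V (lie f s))) => [|g].
  split=> [|e g h Vg Vh]; first by rewrite /lie mul0r mulr0 subrr; case: sV.
  by rewrite lieDl lieZl; case: sV => _; apply.
case=> [pg|[u [v [Ru Rv ->]]]].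
  by apply: powers_sub_power_products; apply: lie_powers; apply: mem_lin_span.
rewrite lieMl; apply: (subspaceD sV) => //; apply: mul_powers => //;
  by first [exact: powB | apply: lie_powers; exact: powB].
Qed.

Let two_neq0 : 2%:R != 0 :> k.
Proof. by rewrite -(dvdn_pcharf pk) gtnNdvd. Qed.

Lemma mul_mul_ad_powers a b x v :
  B a -> B b -> R x -> R v -> V (a * b * ad x p.-1 v).
Proof.
have -> : p.-1 = p.-2.+1 by rewrite [RHS]prednK // ltn_predRL ltnW.
move=> Ba Bb Rx Rv; apply: (@mul_mul_ad _ _ R B) => //.
- exact: lie_powers.
- exact: lie_power_products.
- move=> y w Ry Rw; rewrite [p.-2.+1]prednK ?ltn_predRL 1?ltnW //.
  exact: ad_powers.
- exact: powers_sub_power_products.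
- exact: mul_powers.
Qed.

(* By Jacobson's formula, (x + y) ^+ p - x ^+ p - y ^+ p is a combination of
   values of [ad _ p.-1]. *)
Lemma mul_mul_jacobson a b x y : B a -> B b -> R x -> R y ->
  V (a * b * ((x + y) ^+ p - x ^+ p - y ^+ p)).
Proof.
move=> Ba Bb Rx Ry; pose K s := V (a * b * s).
have sK : subspace K.
  split=> [|e f g Vf Vg]; rewrite /K; first by rewrite mulr0; case: sV.
  by rewrite mulrDr -scalerAr; case: sV => _; apply.
set g := pencil x y ^+ p.
have Kad t : K g^`().[t%:A].
  rewrite horner_deriv_pencil_exp -ad_pchar //; apply: mul_mul_ad_powers => //.
  by case: sR => _; apply.
have szg' : (size g^`() <= p)%N.
  apply/leq_sizeP => j le_pj.
  by rewrite coef_deriv coef_pencil_exp ?leqW // gtn_eqF // mul0rn.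
have Kg j : (j < p.-1)%N -> K g`_j.+1.
  rewrite ltn_predRL => lt_jp.
  have : K (g^`())`_j.
    apply: (subspace_coef infk (n := p)) => [//|t|]; last exact: ltnW.
    by rewrite -horner_alg_wide.
  have j_neq0 : j.+1%:R != 0 :> k by rewrite -(dvdn_pcharf pk) gtnNdvd.
  rewrite coef_deriv -scaler_nat => /(subspaceZ j.+1%:R^-1 sK).
  by rewrite scalerA mulVf // scale1r.
have p_gt0 : (0 < p)%N by rewrite ltnW // ltnW.
have g0 : g`_0 = y ^+ p.
  by have := horner_pencil_exp x y 0 p; rewrite !scale0r add0r horner_coef0.
have recl (F : nat -> A) : \sum_(i < p) F i = F 0%N + \sum_(i < p.-1) F i.+1.
  by case: (p) p_gt0 => // q _; rewrite big_ord_recl.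
have -> : (x + y) ^+ p = \sum_(i < p.-1) g`_i.+1 + x ^+ p + y ^+ p.
  have := horner_pencil_exp x y 1 p.
  rewrite (horner_alg_wide _ (size_pencil_exp x y p)) scale1r => <-.
  under eq_bigr do rewrite expr1n scale1r.
  rewrite big_ord_recr /= coef_pencil_exp // eqxx mulr1n addrAC; congr (_ + _).
  by rewrite recl g0 addrC.
by rewrite addrAC !addrK; apply: (subspace_sum _ sK) => i _; apply: Kg.
Qed.

Lemma mul3_powers x y z : R x -> R y -> R z -> V (z ^+ p * x ^+ p * y ^+ p).
Proof.
move=> Rx Ry Rz; set a := z ^+ p; set X := x ^+ p; set Y := y ^+ p.
have Ba : B a by apply: powB.
have BX : B X by apply: powB.
have BY : B Y by apply: powB.
(* The two products differ by a [c, b], a product of two elements of [B]. *)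
have swap b c : B b -> B c -> V (a * b * c) -> V (a * c * b).
  move=> Bb Bc Vabc; rewrite -mulrA (mul_lie c) mulrDr mulrA.
  by apply: (subspaceD sV) => //; apply: mul_powers => //; apply: lie_powers.
have Rxy : R (x + y) by apply: (subspaceD sR).
pose T := (x + y) ^+ p; have BT : B T by apply: powB.
pose S := T - X - Y.
have ES : T = X + Y + S by rewrite [RHS]addrC [X + Y]addrC addrA !subrK.
have VS b : B b -> V (a * b * S) by move=> Bb; apply: mul_mul_jacobson.
(* Since u^p u^p = (u^2)^p, only two p-th powers are multiplied. *)
have sq u : R u -> V (a * u ^+ p * u ^+ p).
  move=> Ru; rewrite -mulrA -exprMn_comm //; apply: mul_powers => //.
  by apply: powB; apply: RMl.
(* Replace T by X + Y in one factor at a time, starting from a T T: the errors are a T S here and a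
   (X + Y) S below. *)
have VT : V (a * T * (X + Y)).
  rewrite -[X + Y](addrK S) -ES mulrBr.
  by apply: (subspaceB sV) => //; [apply: sq | apply: VS].
have BXY : B (X + Y) by apply: (subspaceD sB).
have VXY : V (a * (X + Y) * (X + Y)).
  rewrite -[X in _ * X](addrK S) -ES mulrBr.
  by apply: (subspaceB sV) => //; [apply: swap | apply: VS].
apply: (subspace_half two_neq0 sV).
have -> : a * X * Y + a * X * Y = a * (X + Y) * (X + Y) - a * X * X - a * Y * Y
    + a * lie X Y.
  rewrite /lie mulrBr !mulrA (mulrDr a X Y) mulrDl !(mulrDr _ X Y).
  (* Pairs each unwanted monomial with its negative. *)
  rewrite [RHS](AC (2*2*1*1*2) (2*7*(1*5)*(4*6)*(3*8)))/=.
  by rewrite !subrr !addr0.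
apply: (subspaceD sV) => //; last by apply: mul_powers => //; apply: lie_powers.
by apply: (subspaceB sV); [apply: (subspaceB sV) => //|]; apply: sq.
Qed.

Lemma power_products_mul_pow f v : V f -> R v -> V (f * v ^+ p).
Proof.
move=> Vf Rv; apply: (Vf (fun f => V (f * v ^+ p))) => [|w].
  split=> [|e g h Vg Vh]; first by rewrite mul0r; case: sV.
  by rewrite mulrDl -scalerAl; case: sV => _; apply.
case=> [[x Rx ->]|[x [y [Rx Ry ->]]]]; last exact: mul3_powers.
by apply: mem_lin_span; right; exists x, v.
Qed.

End Powers.

(** * The free algebra, its T-spaces and one-element substitutions *)

Lemma malg_mulrC (k : comNzRingType) (K : monomType) (a : k) (f : {malg k[K]}) :
  f * a%:MP = a *: f.
Proof.
rewrite [f in LHS]monalgE [f in RHS]monalgE mulr_suml scaler_sumr.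
apply: eq_bigr => m _; rewrite malgM_def fgmulUU mulm1.
by apply/malgP => m'; rewrite mcoeffZ !mcoeffU mulrC mulrnAr.
Qed.

Lemma malg_scalerAr (k : fieldType) (I : choiceType) (a : k)
  (f g : {malg k[{fmonom I}]}) : a *: (f * g) = f * (a *: g).
Proof. by rewrite -!mul_malgC !mulrA malg_mulrC mul_malgC. Qed.

(* Not declared as a canonical instance: the one for commutative monoids already
   occupies the slot of [malg]. *)
Definition free_algebra (k : fieldType) : algType k :=
  HB.pack {malg k[{fmonom nat}]}
    (GRing.Lalgebra_isAlgebra.Build k {malg k[{fmonom nat}]}
       (@malg_scalerAr k nat)).

Section Tspaces.
Variable k : fieldType.
Implicit Types (f g u v : Falg k) (a : k) (V S : Falg k -> Prop).

Lemma in_k0_subspace : subspace (@in_k0 k).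
Proof.
split=> [|a f g f0 g0]; rewrite /in_k0 ?mcoeff0 //.
by rewrite mcoeffD mcoeffZ f0 g0 mulr0 addr0.
Qed.

Lemma in_k0_mull f g : in_k0 g -> in_k0 (f * g).
Proof. by rewrite /in_k0 rmorphM => /= ->; rewrite mulr0. Qed.

Lemma in_k0_mulr f g : in_k0 g -> in_k0 (g * f).
Proof. by rewrite /in_k0 rmorphM => /= ->; rewrite mul0r. Qed.

Lemma in_k0_exp n f : (0 < n)%N -> in_k0 f -> in_k0 (f ^+ n).
Proof. by case: n => // n _ f0; rewrite exprS; apply: in_k0_mulr. Qed.

Lemma in_k0_xvar i : in_k0 (xvar k i).
Proof. by rewrite /in_k0 mcoeffU fm1_eq1. Qed.

Lemma in_k0_Tspace : is_Tspace (@in_k0 k).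
Proof.
have [k00 k0D] := in_k0_subspace; split=> //; split=> //; split=> //.
by move=> phi [phi_k0 _].
Qed.

Lemma Tspace_subspace V : is_Tspace V -> subspace V.
Proof. by case=> _ [V0 [VD _]]. Qed.

Lemma Tgen_Tspace S : (forall f, S f -> in_k0 f) -> is_Tspace (@Tgen k S).
Proof.
move=> Sk0; split=> [f|]; first by apply; [apply: in_k0_Tspace|].
split=> [V [_ [V0 _]] //|]; split=> [a f g Sf Sg V tV SV|phi ephi f Sf V tV SV].
  by case: (tV) => _ [_ [VD _]]; apply: VD; [apply: Sf | apply: Sg].
by case: (tV) => _ [_ [_ Vphi]]; apply: Vphi => //; apply: Sf.
Qed.

Lemma sub_Tgen S f : S f -> @Tgen k S f.
Proof. by move=> Sf V _; apply. Qed.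

Lemma endo0 phi : @is_endo k phi -> phi 0 = 0.
Proof.
have [k00 _] := in_k0_subspace.
case=> _ [/(_ (-1) 0 0 k00 k00) + _].
by rewrite scaler0 addr0 scaleN1r addNr.
Qed.

Lemma endo_exp phi n u :
  is_endo phi -> (0 < n)%N -> in_k0 u -> phi (u ^+ n) = phi u ^+ n.
Proof.
case=> _ [_ phiM]; case: n => // n _ u0; elim: n => // n IHn.
by rewrite exprS phiM //; [rewrite IHn -exprS | apply: in_k0_exp].
Qed.

Lemma lin_span_Tspace S :
    (forall f, S f -> in_k0 f) ->
    (forall phi, is_endo phi -> forall f, S f -> S (phi f)) ->
  is_Tspace (lin_span S).
Proof.
move=> Sk0 Sphi; have [S0 SD] := lin_span_subspace S.
split=> [f Sf|]; first exact: Sf in_k0_subspace Sk0.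
split=> //; split=> // phi ephi f Sf.
have [k00 k0D] := in_k0_subspace; have [_ [phiD _]] := ephi.
suff [] : in_k0 f /\ lin_span S (phi f) by [].
(* Membership in k_0<X> is carried along because [phi] is linear only there. *)
apply: (Sf (fun f => in_k0 f /\ lin_span S (phi f))) => [|g Sg].
  split=> [|a g h [g0 Sg] [h0 Sh]]; first by rewrite endo0.
  by split; [apply: k0D | rewrite phiD //; apply: SD].
by split; [apply: Sk0 | apply: mem_lin_span; apply: Sphi].
Qed.

(** Every letter goes to the same [u]; this suffices because the generator of L_1 involves one
    variable. *)
Definition fmonom_eval (u : Falg k) (m : {fmonom nat}) : Falg k := u ^+ size m.

Lemma fmonom_eval_morphism u : mmorphism (fmonom_eval u).
Proof. by split=> [m m'|]; rewrite /fmonom_eval ?fm1 // fmM size_cat exprD. Qed.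

HB.instance Definition _ u := isMultiplicative.Build _ _ (fmonom_eval u)
  (fmonom_eval_morphism u).

Definition subst u : Falg k -> Falg k :=
  mmap (@malgC {fmonom nat} k) (fmonom_eval u).

Lemma subst_endo u : in_k0 u -> is_endo (subst u).
Proof.
move=> u0.
have com f m m' :
    GRing.comm ((@malgC {fmonom nat} k) f@_m) (fmonom_eval u m').
  by rewrite /GRing.comm malg_mulrC mul_malgC.
have [substM _] := commr_mmap_is_multiplicative com.
split=> [f f0|].
  rewrite /subst mmapE; apply: (subspace_sum _ in_k0_subspace) => m _.
  (* The empty word, which would contribute a constant, has coefficient 0; other words give positive
     powers of [u]. *)
  rewrite mul_malgC /fmonom_eval; have [m1|] := eqVneq m (@mone _).
    by rewrite m1 f0 scale0r; case: in_k0_subspace.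
  rewrite -fdeg_eq0 -lt0n => m_gt0.
  by apply: (subspaceZ _ in_k0_subspace); apply: in_k0_exp.
split=> [a f g _ _|f g _ _]; last exact: substM.
by rewrite /subst mmapD mmapZ /= mul_malgC.
Qed.

Lemma subst_xvar u i : subst u (xvar k i) = u.
Proof. by rewrite /subst mmapU mul1r /fmonom_eval fmuE expr1. Qed.

End Tspaces.

(** * Identification of L_1 and L_2, and the conclusion *)

Section PowerSequence.
Variables (k : fieldType) (p : nat).
Hypothesis p_gt0 : (0 < p)%N.
Implicit Types f u v : Falg k.

Local Notation B := (@powers k (free_algebra k) (@in_k0 k) p).
Local Notation V := (@power_products k (free_algebra k) (@in_k0 k) p).

(* Both sides are convertible, but on the right the power is taken in the
   canonical ring structure of [Falg k] instead of that of [free_algebra k]. *)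
Lemma is_powE f : @is_pow k (free_algebra k) (@in_k0 k) p f <->
  exists2 u, in_k0 u & f = u ^+ p.
Proof. by []. Qed.

Lemma is_pow_mulE f : @is_pow_mul k (free_algebra k) (@in_k0 k) p f <->
  exists u v, [/\ in_k0 u, in_k0 v & f = u ^+ p * v ^+ p].
Proof. by []. Qed.

Lemma is_pow_endo phi f : is_endo phi ->
  @is_pow k (free_algebra k) (@in_k0 k) p f ->
  @is_pow k (free_algebra k) (@in_k0 k) p (phi f).
Proof.
move=> ephi /is_powE[u u0 ->]; apply/is_powE; exists (phi u).
  2: exact: endo_exp.
by case: ephi => + _; apply.
Qed.

Lemma powers_Tspace : is_Tspace B.
Proof.
apply: lin_span_Tspace => [f /is_powE[u u0 ->]|phi ephi f].
  exact: in_k0_exp.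
exact: is_pow_endo.
Qed.

Lemma power_products_Tspace : is_Tspace V.
Proof.
apply: lin_span_Tspace => [f|phi ephi f].
  case=> [/is_powE[u u0 ->]|/is_pow_mulE[u [v [u0 v0 ->]]]].
    exact: in_k0_exp.
  by apply: in_k0_mull; apply: in_k0_exp.
case=> [pf|/is_pow_mulE[u [v [u0 v0 ->]]]]; first by left; apply: is_pow_endo.
have [phi_k0 [_ phiM]] := ephi.
right; apply/is_pow_mulE; exists (phi u), (phi v); split; try exact: phi_k0.
rewrite (phiM _ _ (in_k0_exp p_gt0 u0) (in_k0_exp p_gt0 v0)).
by rewrite (endo_exp ephi p_gt0 u0) (endo_exp ephi p_gt0 v0).
Qed.

Lemma exp_Lrec0 u : in_k0 u -> @Lrec k p 0 (u ^+ p).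
Proof.
move=> u0 W [_ [_ [_ Wphi]]] Wx.
rewrite -[u in u ^+ p](subst_xvar u 1) -endo_exp ?in_k0_xvar //.
- by apply: Wphi; [apply: subst_endo | apply: Wx].
- exact: subst_endo.
- exact: in_k0_xvar.
Qed.

Lemma Lrec0_powers f : @Lrec k p 0 f -> B f.
Proof.
apply; first exact: powers_Tspace.
move=> g ->; apply: mem_lin_span; exists (xvar k 1) => //.
exact: in_k0_xvar.
Qed.

Lemma Lrec_in_k0 n f : @Lrec k p n f -> in_k0 f.
Proof.
elim: n f => [|n IHn] f; apply; try exact: in_k0_Tspace.
  by move=> _ ->; apply: in_k0_exp => //; apply: in_k0_xvar.
by move=> _ [/IHn //|[u [v [_ [v0 ->]]]]]; apply: in_k0_mull; apply: in_k0_exp.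
Qed.

Lemma Lrec_Tspace n : is_Tspace (@Lrec k p n).
Proof.
case: n => [|n]; apply: Tgen_Tspace => f.
  by move=> ->; apply: in_k0_exp => //; apply: in_k0_xvar.
case=> [/Lrec_in_k0 //|[u [v [_ [v0 ->]]]]].
by apply: in_k0_mull; apply: in_k0_exp.
Qed.

(** Indices are shifted: [Lrec 1] is L_2. The explicit span [V] is a T-space containing the
    generators of L_2, and conversely L_2 contains the spanning elements of [V]. *)
Lemma Lrec1E f : @Lrec k p 1 f <-> V f.
Proof.
split=> [|Vf].
  apply; first exact: power_products_Tspace.
  move=> g [/Lrec0_powers|[u [v [/Lrec0_powers Bu [v0 ->]]]]].
    exact: powers_sub_power_products.
  by apply: mul_powers => //; apply: mem_lin_span; exists v.
apply: Vf (Tspace_subspace (Lrec_Tspace 1)) _ => g.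
case=> [/is_powE[u u0 ->]|/is_pow_mulE[u [v [u0 v0 ->]]]]; apply: sub_Tgen.
  by left; apply: exp_Lrec0.
by right; exists (u ^+ p), v; split=> //; apply: exp_Lrec0.
Qed.

End PowerSequence.

Theorem theorem3p1 (k : fieldType) (p : nat) :
  (forall s : seq k, exists x : k, x \notin s) ->
  (p \in [pchar k])%R -> (2 < p)%N ->
  forall f : Falg k, @L k p 2 f <-> @L k p 3 f.
Proof.
move=> infk pk p_gt2 f.
have p_gt0 : (0 < p)%N by rewrite ltnW // ltnW.
split=> [L2f|]; first by apply: sub_Tgen; left.
(* By minimality of L_3, it is enough that its generators lie in the T-space L_2. *)
apply; first exact: Lrec_Tspace.
move=> _ [//|[u [v [/(Lrec1E p_gt0) Vu [v0 ->]]]]].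
apply/(Lrec1E p_gt0).
apply: (@power_products_mul_pow k (free_algebra k)) => //.
- exact: in_k0_subspace.
- exact: in_k0_mull.
- exact: in_k0_mulr.
Qed.
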